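(* The restriction of the supremum norm to $S'(K)$ is measurable with respect to the trace of $\mathrm{Ba}(C(K),w)$ on $S'(K)$.
   Context: Setting. $\mathfrak c$ is the cardinality of the continuum. Fix a cardinal $\kappa$ with $\omega_1\le\kappa\le\mathfrak c$. Let $\lambda$ be the usual product probability measure on the Baire $\sigma$-algebra of $2^\kappa$, and let $\mathfrak B$ be its measure algebra (Baire sets modulo $\lambda$-null sets); $\lambda$ also denotes the induced probability measure on $\mathfrak B$. Boolean operations are written $\cup,\cap,\setminus$, the order is $\subseteq$, the least and greatest elements are $\mathbf 0,\mathbf 1$; for a Boolean algebra $\mathfrak D$, $\mathfrak D^+$ is the set of its nonzero elements; an empty meet is $\mathbf 1$. Let $\mathfrak C=\mathfrak B^{\mathbb N}$ with coordinatewise operations, with elements $c=(c(n))_n$. Fix an independent family $\{N_b: b\in\mathfrak B^+\}$ of subsets of $\mathbb N$, i.e. $\bigcap_{b\in s}N_b\setminus\bigcup_{b'\in t}N_{b'}\ne\emptyset$ for all finite disjoint $s,t\subseteq\mathfrak B^+$. For $b\in\mathfrak B^+$ define $G_b\in\mathfrak C$ by $G_b(n)=b$ if $n\in N_b$ and $G_b(n)=\mathbf 0$ otherwise. Let $\mathfrak A$ be the subalgebra of $\mathfrak C$ generated by $\{G_b:b\in\mathfrak B^+\}$, and let $K$ be the Stone space of all ultrafilters on $\mathfrak A$; for $a\in\mathfrak A$ let $\widehat a=\{\mathcal F\in K: a\in\mathcal F\}$. For finite $r\subseteq\mathfrak B^+$ put $J(r)=\bigcap_{b\in r}G_b\in\mathfrak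 A$. $C(K)$ is the Banach space of real-valued continuous functions on $K$ with the supremum norm. $\mathrm{Ba}(C(K),w)$ is the Baire $\sigma$-algebra of the weak topology of $C(K)$, which coincides with the $\sigma$-algebra on $C(K)$ generated by $C(K)^*$. The trace of a $\sigma$-algebra $\Sigma$ on a subset $E$ is $\{A\cap E: A\in\Sigma\}$. $S(K)$ is the linear span of the characteristic functions of clopen subsets of $K$. $S'(K)$ is the set of all $g\in S(K)$ which can be written as $g=\sum_{r\subseteq s}y_r1_{\widehat{J(r)}}$ for some finite set $s\subseteq\mathfrak B^+$ and some collection of nonzero real numbers $\{y_r:r\subseteq s\}$. *)

(* Defs.v *)
From HB Require Import structures.
From mathcomp Require Import all_boot all_order all_algebra finmap.
From mathcomp Require Import generic_quotient.
From mathcomp Require Import all_classical all_reals all_analysis.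

Set Implicit Arguments.
Unset Strict Implicit.
Unset Printing Implicit Defensive.

Import Order.Theory GRing.Theory Num.Theory.
Import numFieldNormedType.Exports.

Local Open Scope classical_set_scope.
Local Open Scope ring_scope.
Local Open Scope quotient_scope.

(* The Baire sigma-algebra, the smallest one making all continuous real-valued
   functions measurable, is [<<s baire_gen R T >>]. *)
Definition baire_gen (R : realType) (T : topologicalType) : set (set T) :=
  [set A | exists f : T -> R,
    continuous f /\ exists2 U, open U & A = f @^-1` U].

Arguments baire_gen R T : clear implicits.

Definition cube (I : choiceType) : Type := prod_topology (fun _ : I => bool).

Definition baire_cube (R : realType) (I : choiceType) : Type :=
  g_sigma_algebraType (baire_gen R (cube I)).

(* The usual product measure on [2^I] is the probability on the Baire sets that
   gives each cylinder fixing the coordinates in [s] the value [2^-#|s|]; these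
   values determine it by the pi-lambda theorem. *)
Definition is_coin_measure (R : realType) (I : choiceType)
    (lambda : set (baire_cube R I) -> \bar R) :=
  forall (s : {fset I}) (e : I -> bool),
    lambda [set x | forall i, i \in s -> x i = e i] = (2^-1 ^+ #|` s|)%:E.

Section measure_algebra.
Context d (T : measurableType d) (R : realType).
Variable mu : {measure set T -> \bar R}.

Definition mset := {A : set T | `[< measurable A >]}.

Lemma msetP (A : mset) : measurable (\val A).
Proof. exact/asboolP/(valP A). Qed.

Definition Mset (A : set T) (mA : measurable A) : mset :=
  exist _ A (introT (asboolP _) mA).

Definition mset_equiv : rel mset :=
  fun A B => `[< mu (\val A `+` \val B) = 0%E >].

Lemma measurableY (A B : set T) :
  measurable A -> measurable B -> measurable (A `+` B).
Proof. by move=> mA mB; apply: measurableU; exact: measurableD. Qed.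

Lemma mu0S (A B : set T) : measurable A -> measurable B ->
  A `<=` B -> mu B = 0%E -> mu A = 0%E.
Proof. by move=> mA mB AB B0; exact: (subset_measure0 mA mB AB B0). Qed.

Lemma mu0U (A B : set T) : measurable A -> measurable B ->
  mu A = 0%E -> mu B = 0%E -> mu (A `|` B) = 0%E.
Proof. by move=> mA mB A0 B0; rewrite null_set_setU. Qed.

Lemma mset_equiv_refl : reflexive mset_equiv.
Proof. by move=> A; apply/asboolP; rewrite setYK measure0. Qed.

Lemma mset_equiv_sym : symmetric mset_equiv.
Proof. by move=> A B; rewrite /mset_equiv setYC. Qed.

Lemma mset_equiv_trans : transitive mset_equiv.
Proof.
move=> B A C /asboolP AB /asboolP BC; apply/asboolP.
have [mA mB mC] := And3 (msetP A) (msetP B) (msetP C).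
have [mAB mBC] := (measurableY mA mB, measurableY mB mC).
apply: (mu0S (measurableY mA mC) (measurableU _ _ mAB mBC) _
  (mu0U mAB mBC AB BC)).
by move=> x /=; have := EM (\val B x); tauto.
Qed.

Canonical mset_equiv_canonical :=
  EquivRel mset_equiv mset_equiv_refl mset_equiv_sym mset_equiv_trans.

Definition malg := {eq_quot mset_equiv}.

HB.instance Definition _ := Choice.on malg.
HB.instance Definition _ := EqQuotient.on malg.

Definition msetI (A B : mset) : mset := Mset (measurableI _ _ (msetP A) (msetP B)).
Definition msetU (A B : mset) : mset := Mset (measurableU _ _ (msetP A) (msetP B)).
Definition msetC (A : mset) : mset := Mset (measurableC (msetP A)).
Definition mset0 : mset := Mset measurable0.
Definition msetT : mset := Mset measurableT.

Definition malg_meet (a b : malg) : malg := \pi_malg (msetI (repr a) (repr b)).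
Definition malg_join (a b : malg) : malg := \pi_malg (msetU (repr a) (repr b)).
Definition malg_compl (a : malg) : malg := \pi_malg (msetC (repr a)).

Lemma malg_eqP (A B : mset) :
  (\pi_malg A = \pi_malg B) <-> mu (\val A `+` \val B) = 0%E.
Proof.
split; first by move/eqP; rewrite eqmodE => /asboolP.
by move=> AB; apply/eqP; rewrite eqmodE; apply/asboolP.
Qed.

Lemma malg_ext (A B : mset) : \val A = \val B -> \pi_malg A = \pi_malg B.
Proof. by move=> AB; apply/malg_eqP; rewrite AB setYK measure0. Qed.

Lemma repr_null (A : mset) : mu (\val (repr (\pi_malg A)) `+` \val A) = 0%E.
Proof. by apply/malg_eqP; rewrite reprK. Qed.

Lemma malg_meetE (A B : mset) :
  malg_meet (\pi_malg A) (\pi_malg B) = \pi_malg (msetI A B).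
Proof.
apply/malg_eqP => /=; set A' := repr _; set B' := repr _.
have [mA mB mA' mB'] := And4 (msetP A) (msetP B) (msetP A') (msetP B').
have [mYA mYB] := (measurableY mA' mA, measurableY mB' mB).
apply: (mu0S _ (measurableU _ _ mYA mYB) _
  (mu0U mYA mYB (repr_null A) (repr_null B))).
  by apply: measurableY; exact: measurableI.
move=> x /=; rewrite -/A' -/B'.
have := EM (\val A x); have := EM (\val A' x).
by have := EM (\val B x); have := EM (\val B' x); tauto.
Qed.

Lemma malg_joinE (A B : mset) :
  malg_join (\pi_malg A) (\pi_malg B) = \pi_malg (msetU A B).
Proof.
apply/malg_eqP => /=; set A' := repr _; set B' := repr _.
have [mA mB mA' mB'] := And4 (msetP A) (msetP B) (msetP A') (msetP B').
have [mYA mYB] := (measurableY mA' mA, measurableY mB' mB).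
apply: (mu0S _ (measurableU _ _ mYA mYB) _
  (mu0U mYA mYB (repr_null A) (repr_null B))).
  by apply: measurableY; exact: measurableU.
move=> x /=; rewrite -/A' -/B'.
have := EM (\val A x); have := EM (\val A' x).
by have := EM (\val B x); have := EM (\val B' x); tauto.
Qed.

Lemma malg_complE (A : mset) : malg_compl (\pi_malg A) = \pi_malg (msetC A).
Proof.
apply/malg_eqP => /=; set A' := repr _.
have [mA mA'] := (msetP A, msetP A').
apply: (mu0S _ (measurableY mA' mA) _ (repr_null A)).
  by apply: measurableY; exact: measurableC.
move=> x /=; rewrite -/A'.
by have := EM (\val A x); have := EM (\val A' x); tauto.
Qed.

Fact malg_meetC : commutative malg_meet.
Proof.
move=> a b; elim/quotW: a => A; elim/quotW: b => B; rewrite !malg_meetE.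
by apply: malg_ext => /=; apply/seteqP; split => x /=; tauto.
Qed.

Fact malg_joinC : commutative malg_join.
Proof.
move=> a b; elim/quotW: a => A; elim/quotW: b => B; rewrite !malg_joinE.
by apply: malg_ext => /=; apply/seteqP; split => x /=; tauto.
Qed.

Fact malg_meetA : associative malg_meet.
Proof.
move=> a b c; elim/quotW: a => A; elim/quotW: b => B; elim/quotW: c => C;
rewrite (malg_meetE B C) (malg_meetE A B) !malg_meetE.
by apply: malg_ext => /=; apply/seteqP; split => x /=; tauto.
Qed.

Fact malg_joinA : associative malg_join.
Proof.
move=> a b c; elim/quotW: a => A; elim/quotW: b => B; elim/quotW: c => C;
rewrite (malg_joinE B C) (malg_joinE A B) !malg_joinE.
by apply: malg_ext => /=; apply/seteqP; split => x /=; tauto.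
Qed.

Fact malg_joinKI (b a : malg) : malg_meet a (malg_join a b) = a.
Proof.
elim/quotW: a => A; elim/quotW: b => B;
rewrite (malg_joinE A B) malg_meetE.
by apply: malg_ext => /=; apply/seteqP; split => x /=; tauto.
Qed.

Fact malg_meetKU (b a : malg) : malg_join a (malg_meet a b) = a.
Proof.
elim/quotW: a => A; elim/quotW: b => B;
rewrite (malg_meetE A B) malg_joinE.
by apply: malg_ext => /=; apply/seteqP; split => x /=; tauto.
Qed.

Fact malg_meetUl : left_distributive malg_meet malg_join.
Proof.
move=> a b c; elim/quotW: a => A; elim/quotW: b => B; elim/quotW: c => C.
rewrite (malg_joinE A B) (malg_meetE A C) (malg_meetE B C) malg_meetE malg_joinE.
by apply: malg_ext => /=; apply/seteqP; split => x /=; tauto.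
Qed.

Fact malg_meetxx : idempotent_op malg_meet.
Proof.
by move=> a; elim/quotW: a => A; rewrite malg_meetE; apply: malg_ext => /=; apply/seteqP; split => x /=; tauto.
Qed.

Fact malg_display : Order.disp_t. Proof. exact: (Order.Disp tt tt). Qed.

HB.instance Definition _ := @Order.isMeetJoinDistrLattice.Build malg_display malg
  (fun a b => malg_meet a b == a) (fun a b => (b != a) && (malg_meet a b == a))
  malg_meet malg_join (fun _ _ => erefl) (fun _ _ => erefl)
  malg_meetC malg_joinC malg_meetA malg_joinA
  malg_joinKI malg_meetKU malg_meetUl malg_meetxx.

Fact malg_le0x (a : malg) : (\pi_malg mset0 <= a)%O.
Proof.
elim/quotW: a => A; apply/eqP; rewrite [LHS]malg_meetE.
by apply: malg_ext => /=; apply/seteqP; split => x /=; tauto.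
Qed.

Fact malg_lex1 (a : malg) : (a <= \pi_malg msetT)%O.
Proof.
elim/quotW: a => A; apply/eqP; rewrite [LHS]malg_meetE.
by apply: malg_ext => /=; apply/seteqP; split => x /=; tauto.
Qed.

HB.instance Definition _ := Order.hasBottom.Build malg_display malg malg_le0x.
HB.instance Definition _ := Order.hasTop.Build malg_display malg malg_lex1.

Fact malg_joinxC (a : malg) : (a `|` malg_compl a)%O = \top%O.
Proof.
elim/quotW: a => A; rewrite malg_complE [LHS]malg_joinE.
apply: malg_ext => /=; apply/seteqP; split => x /=.
  by have := EM (\val A x); tauto.
by have := EM (\val A x); tauto.
Qed.

Fact malg_meetxC (a : malg) : (a `&` malg_compl a)%O = \bot%O.
Proof.
elim/quotW: a => A; rewrite malg_complE [LHS]malg_meetE.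
by apply: malg_ext; rewrite /= setICr.
Qed.

HB.instance Definition _ := Order.TBDistrLattice_hasComplement.Build
  malg_display malg malg_joinxC malg_meetxC.

End measure_algebra.

Section power.
Context d (B : ctbDistrLatticeType d).

(* Meets, joins and the order are the pointwise ones of [boolp]. *)
Definition powN := nat -> B.

HB.instance Definition _ := Order.Lattice.on powN.

Fact powN_meetUl : @left_distributive powN powN Order.meet Order.join.
Proof. by move=> f g h; apply/funext => n; exact: meetUl. Qed.

HB.instance Definition _ :=
  Order.Lattice_Meet_isDistrLattice.Build _ powN powN_meetUl.

Fact powN_le0x (f : powN) : ((fun=> \bot%O) <= f)%O.
Proof. by apply/lefP => n; exact: le0x. Qed.

Fact powN_lex1 (f : powN) : (f <= (fun=> \top%O))%O.
Proof. by apply/lefP => n; exact: lex1. Qed.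

HB.instance Definition _ := Order.hasBottom.Build _ powN powN_le0x.
HB.instance Definition _ := Order.hasTop.Build _ powN powN_lex1.

Fact powN_joinxC (f : powN) : (f `|` (fun n => ~` f n))%O = \top%O :> powN.
Proof. by apply/funext => n; exact: joinxC. Qed.

Fact powN_meetxC (f : powN) : (f `&` (fun n => ~` f n))%O = \bot%O :> powN.
Proof. by apply/funext => n; exact: meetxC. Qed.

HB.instance Definition _ := Order.TBDistrLattice_hasComplement.Build
  _ powN powN_joinxC powN_meetxC.

End power.

Section generated_subalgebra.
Context d (C : ctbDistrLatticeType d).

Definition is_subalgebra (S : set C) : Prop :=
  [/\ S \bot%O, S \top%O,
      forall a b, S a -> S b -> S (a `&` b)%O,
      forall a b, S a -> S b -> S (a `|` b)%O
    & forall a, S a -> S (~` a)%O].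

Variable G : set C.

Definition gen_pred : pred C := fun c => c \in smallest is_subalgebra G.

Definition gen_alg := {c : C | gen_pred c}.

HB.instance Definition _ := SubChoice.on gen_alg.

Fact smallest_subalgebra : is_subalgebra (smallest is_subalgebra G).
Proof.
split=> [S [[]]|S [[]]|a b Sa Sb S SG|a b Sa Sb S SG|a Sa S SG] //.
- by case: (SG) => -[_ _ + _ _] _; apply; [exact: Sa|exact: Sb].
- by case: (SG) => -[_ _ _ + _] _; apply; [exact: Sa|exact: Sb].
- by case: (SG) => -[_ _ _ _ +] _; apply; exact: Sa.
Qed.

Fact gen_predI : meet_closed gen_pred.
Proof.
move=> a b; rewrite !unfold_in !inE.
by have [_ _ + _ _] := smallest_subalgebra; apply.
Qed.

Fact gen_predU : join_closed gen_pred.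
Proof.
move=> a b; rewrite !unfold_in !inE.
by have [_ _ _ + _] := smallest_subalgebra; apply.
Qed.

Fact gen_pred0 : \bot%O \in gen_pred.
Proof. by rewrite unfold_in inE; have [] := smallest_subalgebra. Qed.

Fact gen_pred1 : \top%O \in gen_pred.
Proof. by rewrite unfold_in inE; have [] := smallest_subalgebra. Qed.

Fact gen_predC a : a \in gen_pred -> (~` a)%O \in gen_pred.
Proof.
rewrite !unfold_in !inE.
by have [_ _ _ _ +] := smallest_subalgebra; apply.
Qed.

HB.instance Definition _ := Order.SubChoice_isTBSubLattice.Build
  d C gen_pred d gen_alg gen_predI gen_predU gen_pred0 gen_pred1.

Lemma val_meet (a b : gen_alg) : val (a `&` b)%O = (val a `&` val b)%O.
Proof. by []. Qed.

Lemma val_join (a b : gen_alg) : val (a `|` b)%O = (val a `|` val b)%O.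
Proof. by []. Qed.

Lemma val_bot : val (\bot%O : gen_alg) = \bot%O.
Proof. by []. Qed.

Lemma val_top : val (\top%O : gen_alg) = \top%O.
Proof. by []. Qed.

Fact gen_alg_meetUl : @left_distributive gen_alg gen_alg Order.meet Order.join.
Proof. by move=> a b c; apply: val_inj; rewrite !(val_meet, val_join) meetUl. Qed.

HB.instance Definition _ :=
  Order.Lattice_Meet_isDistrLattice.Build d gen_alg gen_alg_meetUl.

Definition gen_compl (a : gen_alg) : gen_alg :=
  exist _ (~` val a)%O (gen_predC (valP a)).

Fact gen_joinxC (a : gen_alg) : (a `|` gen_compl a)%O = \top%O.
Proof. by apply: val_inj; rewrite val_join val_top /= joinxC. Qed.

Fact gen_meetxC (a : gen_alg) : (a `&` gen_compl a)%O = \bot%O.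
Proof. by apply: val_inj; rewrite val_meet val_bot /= meetxC. Qed.

HB.instance Definition _ :=
  Order.TBDistrLattice_hasComplement.Build d gen_alg gen_joinxC gen_meetxC.

Fact mem_gen (c : C) : G c -> gen_pred c.
Proof. by move=> Gc; rewrite /gen_pred inE => S [_]; apply. Qed.

End generated_subalgebra.

HB.mixin Record isCompactSpace T & Topological T := {
  compactT : compact [set: T]
}.

#[short(type="compactType")]
HB.structure Definition CompactSpace := { T of Topological T & isCompactSpace T }.

Section stone.
Context d (D : ctbDistrLatticeType d).

Definition is_ultrafilter (F : set D) : Prop :=
  [/\ F \top%O, ~ F \bot%O,
      forall a b, F a -> F b -> F (a `&` b)%O,
      forall a b, (a <= b)%O -> F a -> F b
    & forall a, F a \/ F (~` a)%O].

Definition stone := {F : set D | `[< is_ultrafilter F >]}.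

HB.instance Definition _ := Choice.on stone.

Definition hat (a : D) : set stone := [set F | (val F : set D) a].

Lemma stoneP (F : stone) : is_ultrafilter (val F).
Proof. exact/asboolP/(valP F). Qed.

Lemma hatI a b : hat (a `&` b)%O = hat a `&` hat b.
Proof.
apply/seteqP; split=> F; have [_ _ FI FS _] := stoneP F; last by case; exact: FI.
by move=> Fab; split; apply: FS Fab; [exact: leIl|exact: leIr].
Qed.

Lemma hatC a : hat (~` a)%O = ~` hat a.
Proof.
apply/seteqP; split=> F; have [_ F0 FI _ FC] := stoneP F.
- by move=> FCa Fa; apply: F0; rewrite -(meetxC a); exact: FI.
- by move=> nFa; case: (FC a).
Qed.

Lemma hat1 : hat \top%O = setT.
Proof. by apply/seteqP; split=> // F _; have [] := stoneP F. Qed.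

Fact stone_cover : \bigcup_(U in range hat) U = [set: stone].
Proof.
by apply/seteqP; split=> // F _; exists setT => //; exists \top%O => //; exact: hat1.
Qed.

Fact stone_join (U V : set stone) F : range hat U -> range hat V -> U F -> V F ->
  exists W, [/\ range hat W, W F & W `<=` U `&` V].
Proof.
move=> [a _ <-] [b _ <-] Fa Fb; exists (hat a `&` hat b); split=> //.
by exists (a `&` b)%O => //; exact: hatI.
Qed.

HB.instance Definition _ :=
  @isBaseTopological.Build stone (set stone) (range hat) id stone_cover stone_join.

Lemma open_hat a : open (hat a).
Proof. by exists [set hat a]; [move=> _ ->; exists a|rewrite bigcup_set1]. Qed.

Lemma clopen_hat a : clopen (hat a).
Proof.
split; first exact: open_hat.
by rewrite -[hat a]setCK -hatC; apply: open_closedC; exact: open_hat.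
Qed.

Fact stone_compact : compact [set: stone].
Proof.
rewrite compact_ultra => U UU _.
have Uhat : is_ultrafilter [set a | U (hat a)].
  split=> /=.
  - by rewrite hat1; exact: filterT.
  - rewrite -(meetxC \top%O) hatI hatC setICr; exact: filter_not_empty.
  - by move=> a b Ua Ub; rewrite hatI; exact: filterI.
  - move=> a b ab; apply: filterS => F; have [_ _ _ FS _] := stoneP F.
    exact: FS.
  - by move=> a; rewrite hatC; exact: in_ultra_setVsetC.
pose F : stone := exist (fun F => `[< is_ultrafilter F >]) _ (asboolT Uhat).
exists F; split=> // V [W [[X XD <-] [Y XY YF]] WV].
apply: filterS WV _; have [a _ Ya] := XD _ XY.
apply: (@filterS _ U _ Y); first by move=> F' YF'; exists Y.
by move: YF; rewrite -Ya.
Qed.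

HB.instance Definition _ := isCompactSpace.Build stone stone_compact.

End stone.

Section continuous_functions.
Context (R : realType) (K : compactType).

Definition cont_pred : {pred K -> R} := [pred f | `[< continuous f >]].

Definition CK := {f : K -> R | cont_pred f}.

HB.instance Definition _ := SubChoice.on CK.

Definition CK_fun (f : CK) : K -> R := val f.
Coercion CK_fun : CK >-> Funclass.

Fact cont_submod : submod_closed cont_pred.
Proof.
split; first by apply/asboolP => x; exact: cvg_cst.
move=> a f g /asboolP cf /asboolP cg; apply/asboolP => x.
by apply: cvgD; [apply: cvgZr; exact: cf|exact: cg].
Qed.

HB.instance Definition _ :=
  GRing.isSubmodClosed.Build R (K -> R) cont_pred cont_submod.
HB.instance Definition _ := [SubChoice_isSubLmodule of CK by <:].

Lemma CK_continuous (f : CK) : continuous f.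
Proof. exact/asboolP/(valP f). Qed.

Definition sup_norm (f : CK) : R := sup (range (fun x => `|f x|)).

Lemma CK_bounded (f : CK) : has_ubound (range (fun x => `|f x|)).
Proof.
have : compact (f @` [set: K]).
  by apply: continuous_compact (@compactT K); exact: continuous_subspaceT (@CK_continuous f).
move=> /compact_bounded [M [_ Mf]]; exists (M + 1) => _ [x _ <-].
by apply: (Mf (M + 1)); [rewrite ltrDl|exists x].
Qed.

Lemma ler_sup_norm (f : CK) x : `|f x| <= sup_norm f.
Proof. by apply: ub_le_sup; [exact: CK_bounded|exists x]. Qed.

Lemma sup_norm_le (f : CK) (M : R) :
  0 <= M -> (forall x, `|f x| <= M) -> sup_norm f <= M.
Proof.
move=> M0 fM; have [[y Ey]|E0] := pselect (range (fun x => `|f x|) !=set0).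
  by apply: ge_sup; [exists y|move=> _ [x _ <-]].
by rewrite /sup_norm (proj1 (nonemptyPn _) E0) sup0.
Qed.

Lemma sup_norm_ge0 (f : CK) : 0 <= sup_norm f.
Proof.
have [[y [x _ _]]|E0] := pselect (range (fun x => `|f x|) !=set0).
  exact: le_trans (normr_ge0 _) (ler_sup_norm f x).
by rewrite /sup_norm (proj1 (nonemptyPn _) E0) sup0.
Qed.

Fact sup_normD (f g : CK) : sup_norm (f + g) <= sup_norm f + sup_norm g.
Proof.
apply: sup_norm_le => [|x]; first by rewrite addr_ge0// sup_norm_ge0.
by apply: le_trans (ler_normD _ _) _; apply: lerD; exact: ler_sup_norm.
Qed.

Fact sup_normZ (a : R) (f : CK) : sup_norm (a *: f) = `|a| * sup_norm f.
Proof.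
have leZ (b : R) (h : CK) : sup_norm (b *: h) <= `|b| * sup_norm h.
  apply: sup_norm_le => [|x]; first by rewrite mulr_ge0// sup_norm_ge0.
  by rewrite /= [X in `|X|](_ : _ = b * h x)// normrM ler_wpM2l// ler_sup_norm.
apply/le_anti; rewrite leZ/=; have [->|a0] := eqVneq a 0.
  by rewrite normr0 mul0r sup_norm_ge0.
rewrite -ler_pdivlMl ?normr_gt0// -normfV.
by apply: le_trans (leZ _ _); rewrite scalerA mulVf// scale1r.
Qed.

Fact sup_norm_eq0 (f : CK) : sup_norm f = 0 -> f = 0.
Proof.
move=> f0; apply: val_inj; apply/funext => x; apply/eqP.
by rewrite -normr_le0 -f0; exact: ler_sup_norm.
Qed.

HB.instance Definition _ :=
  Lmodule_isNormed.Build R CK sup_normD sup_normZ sup_norm_eq0.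

Definition SK : set CK :=
  [set g | exists (n : nat) (U : 'I_n -> set K) (y : 'I_n -> R),
    (forall i, clopen (U i)) /\
    forall x, g x = \sum_(i < n) y i * \1_(U i) x].

End continuous_functions.

Section weak_topology.
Context (R : realType) (E : normedModType R).

Definition dual := {phi : {linear E -> R^o} | continuous phi}.

(* The weak topology is the initial topology of the evaluation map from [E] to
   the product [R^dual]. *)
Definition dual_eval (x : E) : prod_topology (fun _ : dual => R) :=
  fun phi => sval phi x.

Definition weak := initial_topology dual_eval.

End weak_topology.

Section construction.
Context d (B : ctbDistrLatticeType d).

(* [pos] is [B^+], so that finite subsets of [B^+] are finite sets over a type. *)
Definition pos := {b : B | b != \bot%O}.

Definition independent (N : pos -> set nat) : Prop :=
  forall s t : {fset pos}, [disjoint s & t]%fset ->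
    exists n, (forall b, b \in s -> N b n) /\ (forall b, b \in t -> ~ N b n).

Variable N : pos -> set nat.

Definition Gseq (b : pos) : powN B :=
  fun n => if n \in N b then val b else \bot%O.

Definition algA := gen_alg (range Gseq).

Definition G (b : pos) : algA :=
  exist _ (Gseq b) (mem_gen (imageT Gseq b)).

Definition J (r : {fset pos}) : algA := (\meet_(b <- r) G b)%O.

Definition K := stone algA.

Definition SK' (R : realType) : set (CK R K) :=
  [set g | SK g /\ exists (s : {fset pos}) (y : {fset pos} -> R),
    (forall r, (r `<=` s)%fset -> y r != 0) /\
    forall x, g x = \sum_(r <- fpowerset s) y r * \1_(hat (J r)) x].

End construction.

Arguments SK' {d B} N R.

(* Main.v *)
From HB Require Import structures.
Require Import Defs.
From mathcomp Require Import all_boot all_order all_algebra finmap.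
From mathcomp Require Import generic_quotient.
From mathcomp Require Import all_classical all_reals all_analysis.
From mathcomp Require Import measurable_realfun.
Import Order.Theory GRing.Theory Num.Theory.
Import numFieldNormedType.Exports.
Local Open Scope classical_set_scope.
Local Open Scope ring_scope.

(** Sending a point of [K] to the set of generators [G b] that it contains
    identifies [K] with the space of all families [P] of nonzero elements of
    the measure algebra in which every finite meet is nonzero: the independence
    of [N] imposes no other relation on the generators.  Under this
    identification [1_(hat (J r))] is the condition [r `<=` P], so that
    [g = \sum_(r `<=` s) y r * 1_(hat (J r))] takes the value
    [\sum_(r `<=` t) y r] at the points with trace [t] on [s], and [`|g|] is
    the maximum of [`|\sum_(r `<=` t) y r|] over the [t `<=` s] whose meet has
    nonzero measure, i.e. [mass t != 0] ([mass_gens_in], [mass_point]).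

    It remains to read the coefficients [y r] off countably many functionals.
    A random family [P] yields a functional with value
    [\sum_r y r * Prob (r `<=` P)] at [g] ([dual_of_measure]).  For a random
    point [x] and a fixed set [Q] of generators, the family of the [b] in [Q]
    containing [x] gives [\sum_(r `<=` Q) y r * mass r] ([dual_mass]); using
    two independent random points instead gives
    [\sum_(r `<=` Q) y r * mass r ^+ 2] ([dual_mass2]).

    Only countably many sets [Q] are used: unions of cells, where for each [j]
    the cell of [b] records which of [0, ..., j - 1] belong to [N b].
    Moebius inversion turns the two families of functionals into
    [a u = \sum_r y r * mass r] and [c u = \sum_r y r * mass r ^+ 2], the sums
    being over the [r] that meet exactly the cells in [u].  Once [j] is so
    large that distinct elements of [s] lie in distinct cells, each of these
    sums has at most one term; as [y r != 0], the condition [a u != 0] tells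
    that the meet of [r] is nonzero, and then [a u ^+ 2 / c u = y r].  Hence
    the maximum over [u] with [a u != 0] of
    [`|\sum_(v \subset u) a v ^+ 2 / c v|], which is a measurable function of
    [g] ([measurable_approx_norm]), equals [`|g|] for all large [j]
    ([approx_normE]).  The set of all [g] at which these functions eventually
    lie in [Y] then has the required trace on [SK']. *)

(** * Ultrafilters of a measure algebra *)

Section measure_algebra.
Local Open Scope quotient_scope.
Local Set Implicit Arguments.
Local Unset Strict Implicit.
Context d (T : measurableType d) (R : realType) (mu : {measure set T -> \bar R}).

Definition rep (a : malg mu) : set T := \val (repr a).

Lemma measurable_rep a : measurable (rep a).
Proof. exact: msetP. Qed.

Lemma malg_eq0 (A : Defs.mset T) : \pi_(malg mu) A = \bot%O <-> mu (\val A) = 0%E.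
Proof. by rewrite -[X in mu X]setY0; exact: malg_eqP. Qed.

Lemma rep_eq0 (a : malg mu) : a = \bot%O <-> mu (rep a) = 0%E.
Proof. by rewrite -malg_eq0 reprK. Qed.

(** The sets that are almost surely implied by a non-null [a] form a proper
    filter; an ultrafilter of sets extending it respects null sets, so it
    descends to the measure algebra. *)
Lemma malg_ultrafilter (a : malg mu) :
  a != \bot%O -> exists F : set (malg mu), is_ultrafilter F /\ F a.
Proof.
move=> a0; have mua : mu (rep a) <> 0%E by move/rep_eq0/eqP; rewrite (negPf a0).
pose FF : set_system T :=
  [set X | exists Z, [/\ measurable Z, mu Z = 0%E & rep a `\` Z `<=` X]].
have FFp : ProperFilter FF.
  split=> [[Z [mZ Z0]]|].
    rewrite subset0 setD_eq0 => aZ; apply: mua.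
    exact: (subset_measure0 (measurable_rep a) mZ aZ Z0).
  split=> [|X Y [Z [mZ Z0 ZX]] [W [mW W0 WY]]|X Y XY [Z [mZ Z0 ZX]]].
  - by exists set0; split=> //; exact: measure0.
  - exists (Z `|` W); split; [exact: measurableU|exact: mu0U|].
    move=> x [ax ZWx]; split; [apply: ZX|apply: WY]; split=> // Hx;
      by apply: ZWx; first [by left|by right].
  - by exists Z; split=> //; exact: subset_trans ZX XY.
have [U [UU FU]] := ultraFilterLemma FFp.
(* [U] contains every conull set, hence does not distinguish sets with null
   difference. *)
have Unull (C D : Defs.mset T) : mu (\val C `+` \val D) = 0%E -> U (\val C) -> U (\val D).
  move=> CD0 UC; have mCD := measurableY (msetP C) (msetP D).
  have : U (~` (\val C `+` \val D)).
    by apply: FU; exists (\val C `+` \val D); split=> // x [].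
  apply: filterS2 UC => x Cx CDx; apply: contrapT => Dx.
  by apply: CDx; left.
have Upi (A : Defs.mset T) : U (rep (\pi_(malg mu) A)) <-> U (\val A).
  split; apply: Unull; first exact: repr_null.
  by rewrite setYC; exact: repr_null.
have UI (b c : malg mu) : U (rep b) -> U (rep c) -> U (rep (b `&` c)%O).
  by move=> Ub Uc; apply/Upi; exact: filterI.
exists [set b | U (rep b)]; split; last first.
  by apply: FU; exists set0; split=> // x [].
split=> //=.
- by apply/Upi; exact: filterT.
- by move/Upi; exact: filter_not_empty.
- move=> b c; rewrite leEmeet => /eqP bc; rewrite -{1}bc => /Upi; apply: filterS.
  by move=> x [].
- move=> b; have [Ub|Ub] := in_ultra_setVsetC (rep b) UU; first by left.
  by right; apply/Upi.
Qed.

End measure_algebra.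

(** * Points of the Stone space *)

Section points.
Local Set Implicit Arguments.
Local Unset Strict Implicit.
Context d (B : ctbDistrLatticeType d) (N : pos B -> set nat).
Local Notation K := (K N).

Lemma hat_J (r : {fset pos B}) (F : K) :
  hat (J N r) F <-> forall b, b \in r -> hat (G N b) F.
Proof.
have [F1 _ FI FS _] := stoneP F; split=> [FJ b br|FG].
  by apply: FS FJ; exact: meets_inf_seq.
rewrite /J /hat /= big_seq; elim/big_ind: _ => //.
Qed.

Lemma val_J_le (r : {fset pos B}) b n :
  b \in r -> ((val (J N r) : powN B) n <= val b)%O.
Proof.
move=> br; have Jb : (J N r <= G N b)%O by exact: meets_inf_seq.
have /lefP/(_ n) Jbn : (val (J N r) <= Gseq N b)%O by exact: Jb.
by apply: le_trans Jbn _; rewrite /Gseq; case: ifP => _ //; exact: le0x.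
Qed.

(** The generators in a point have nonzero meet: [J r] is nonzero, hence nonzero
    at some coordinate [n], and there it lies below every [b] in [r]. *)
Lemma hat_le_meet (F : K) (r : {fset pos B}) :
  (forall b, b \in r -> hat (G N b) F) ->
  exists2 c : B, c != \bot%O & forall b, b \in r -> (c <= val b)%O.
Proof.
move=> /hat_J FJ; have [_ F0 _ _ _] := stoneP F.
have [n Jn] : exists n, (val (J N r) : powN B) n != \bot%O.
  apply: contrapT => /forallNP J0; apply: F0; suff <- : J N r = \bot%O by [].
  by apply: val_inj; apply/funext => n; apply: contrapT => /eqP; exact: J0.
by exists ((val (J N r) : powN B) n) => // b; exact: val_J_le.
Qed.

(** Independence provides a coordinate [n] that lies in [N b] for [b] in [t] and
    outside [N b] for the other [b] in [s]; evaluate at [n] and use an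
    ultrafilter containing [c]. *)
Lemma point_of_meet (indepN : independent N)
    (ultraB : forall c : B, c != \bot%O -> exists U, is_ultrafilter U /\ U c)
    (s t : {fset pos B}) (c : B) :
  c != \bot%O -> (forall b, b \in t -> (c <= val b)%O) ->
  exists F : K, forall b, b \in s -> (hat (G N b) F <-> b \in t).
Proof.
move=> /ultraB [U [[U1 U0 UI US UC] Uc]] ct.
have tsD : [disjoint t & s `\` t]%fset.
  by apply/fdisjointP => b bt; rewrite inE bt.
have [n [tn sn]] := indepN _ _ tsD.
have FP : is_ultrafilter [set a : algA N | U ((val a : powN B) n)].
  split=> //= [a b Ua Ub|a b ab]; first exact: UI.
  apply: US; by have /lefP/(_ n) : (val a <= val b)%O by exact: ab.
exists (exist (fun F => `[< is_ultrafilter F >]) _ (asboolT FP)) => b bs.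
rewrite /hat /= /Gseq; case: (boolP (b \in t)) => bt; split=> //.
- by move=> _; rewrite ifT ?inE; [exact: US (ct b bt) Uc|exact: tn].
- rewrite ifF; first by move/U0.
  by apply/negP; rewrite inE; apply: sn; rewrite inE bt.
Qed.

Definition gens_in (s : {fset pos B}) (F : K) : {fset pos B} :=
  [fset b in s | `[< hat (G N b) F >]]%fset.

Lemma sum_gens_in (R : realType) (g : CK R K) s (y : {fset pos B} -> R) :
  (forall x, g x = \sum_(r <- fpowerset s) y r * \1_(hat (J N r)) x) ->
  forall F, g F = \sum_(r <- fpowerset s) y r * (r `<=` gens_in s F)%fset%:R.
Proof.
move=> gE F; rewrite gE big_seq [RHS]big_seq; apply: eq_bigr => r.
rewrite fpowersetE indicE => rs; congr (_ * _%:R); congr nat_of_bool.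
apply/idP/idP.
  rewrite inE => /hat_J rF; apply/fsubsetP => b br.
  by rewrite !inE /= (fsubsetP rs _ br); apply/asboolP; exact: rF.
move=> rF; rewrite inE; apply/hat_J => b br.
by have := fsubsetP rF _ br; rewrite !inE /= => /andP[_ /asboolP].
Qed.

End points.

(** * Functionals obtained from random families of generators *)

Lemma ultralimit_bounded (R : realType) (S : Type) (U : set_system S)
    (UU : UltraFilter U) (f : S -> R) (M : R) :
  (forall x, `|f x| <= M) -> exists2 l, `|l| <= M & f x @[x --> U] --> l.
Proof.
move=> fM; have UM : (f x @[x --> U]) `[- M, M]%classic.
  by apply: (@filterE _ U) => x /=; rewrite in_itv /= -ler_norml.
have [l [/= lM fl]] := segment_compact (fmap_proper_filter _ _) UM.
exists l; first by rewrite ler_norml; move: lM; rewrite in_itv.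
move=> V Vl; have [//|UVC] := in_ultra_setVsetC (f @^-1` V) UU.
by have [x []] := fl (~` V) V UVC Vl.
Qed.

Definition fset_filter (X : choiceType) : set_system {fset X} :=
  [set S | exists s0 : {fset X}, forall s, (s0 `<=` s)%fset -> S s].

Lemma fset_filter_proper (X : choiceType) : ProperFilter (fset_filter X).
Proof.
split=> [[s0 /(_ s0 (fsubset_refl _))]//|].
split=> [|S S' [s Ss] [s' Ss']|S S' SS' [s Ss]].
- by exists fset0.
- exists (s `|` s')%fset => t; rewrite fsubUset => /andP[st s't].
  by split; [exact: Ss|exact: Ss'].
- by exists s => t st; apply: SS'; exact: Ss.
Qed.

Section functional.
Local Set Implicit Arguments.
Local Unset Strict Implicit.
Context d (B : ctbDistrLatticeType d) (N : pos B -> set nat).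
Local Notation K := (K N).
Context d' (T : measurableType d') (R : realType) (nu : {measure set T -> \bar R}).
Context (A : pos B -> set T).

Definition joint (r : {fset pos B}) : set T := \bigcap_(b in [set` r]) A b.

(** The atom of the algebra generated by the [A b], [b] in [s], on which the
    random family [fun x => {b | A b x}] has trace [t] on [s]. *)
Definition atom (s t : {fset pos B}) : set T :=
  [set x | forall b, b \in s -> (A b x <-> b \in t)].

Context (mA : forall b, measurable (A b)) (nuT : nu setT = 1%E).
Context (point_of_joint : forall s t : {fset pos B}, nu (joint t) <> 0%E ->
  exists F : K, forall b, b \in s -> (hat (G N b) F <-> b \in t)).

Lemma measurable_joint r : measurable (joint r).
Proof. by apply: fin_bigcap_measurable => //; exact: finite_fset. Qed.

Lemma atomE s t : atom s t =
  \bigcap_(b in [set` s]) (if b \in t then A b else ~` A b).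
Proof.
apply/seteqP; split=> x /= xst b bs; have := xst b bs; case: ifP => // bt.
- by move=> [_ ]; apply.
- by case=> + _ Abx => /(_ Abx).
Qed.

Lemma measurable_atom s t : measurable (atom s t).
Proof.
rewrite atomE; apply: fin_bigcap_measurable => [|b _]; first exact: finite_fset.
by case: ifP => _ //; exact: measurableC.
Qed.

Lemma measure_fin_num X : measurable X -> nu X \is a fin_num.
Proof.
move=> mX; rewrite ge0_fin_numE//.
by rewrite (le_lt_trans _ (ltry 1))// -nuT le_measure ?inE.
Qed.

(** A point of [joint r] lies in exactly one atom, and the trace of that atom
    contains [r]. *)
Lemma sum_atom (s r : {fset pos B}) : (r `<=` s)%fset ->
  \sum_(t <- fpowerset s) fine (nu (atom s t)) * (r `<=` t)%fset%:R
  = fine (nu (joint r)).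
Proof.
move=> rs.
pose P := [fset t in fpowerset s | (r `<=` t)%fset]%fset.
have -> : joint r = \big[setU/set0]_(t <- P) atom s t.
  rewrite -bigcup_fset; apply/seteqP; split=> [x rx|x [t]].
    exists [fset b in s | `[< A b x >]]%fset => /=.
      rewrite !inE fpowersetE /=; apply/andP; split.
        by apply/fsubsetP => b; rewrite !inE => /andP[].
      apply/fsubsetP => b br; rewrite !inE /= (fsubsetP rs _ br) /=.
      by apply/asboolP; exact: rx.
    by move=> b bs; rewrite !inE bs /=; split=> [/asboolP|/asboolP].
  rewrite /= !inE /= => /andP[_ rt] xt b br.
  by apply/(xt b (fsubsetP rs _ br)); exact: (fsubsetP rt).
rewrite measure_fbigsetU; last 2 first.
- by move=> t _; exact: measurable_atom.
- move=> t t'; rewrite /P /= !inE /= !fpowersetE => /andP[ts _] /andP[t's _] [x [xt xt']].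
  apply/fsetP => b; apply/idP/idP => bt.
    have bs := fsubsetP ts _ bt.
    by apply/(xt' b bs)/(xt b bs).
  have bs := fsubsetP t's _ bt.
  by apply/(xt b bs)/(xt' b bs).
rewrite -sum_fine; last by move=> t _; apply: measure_fin_num; exact: measurable_atom.
rewrite -big_fset_condE [RHS]big_mkcond /=.
by apply: eq_bigr => t _; case: ifP => _; rewrite ?mulr1 ?mulr0.
Qed.

Lemma point_choice : exists pt : {fset pos B} -> {fset pos B} -> K,
  forall s t, nu (joint t) <> 0%E ->
    forall b, b \in s -> (hat (G N b) (pt s t) <-> b \in t).
Proof.
have [F0 _] : exists F : K, forall b, b \in (fset0 : {fset pos B}) ->
    (hat (G N b) F <-> b \in (fset0 : {fset pos B})).
  apply: point_of_joint; rewrite /joint set_fset0 bigcap_set0 nuT.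
  by apply/eqP; rewrite onee_neq0.
have /choice[pt ptP] (st : {fset pos B} * {fset pos B}) : exists F : K,
    nu (joint st.2) <> 0%E -> forall b, b \in st.1 ->
    (hat (G N b) F <-> b \in st.2).
  have [/(point_of_joint st.1)[F FP]|n0] := pselect (nu (joint st.2) <> 0%E).
    by exists F.
  by exists F0.
by exists (fun s t => pt (s, t)) => s t; exact: (ptP (s, t)).
Qed.

(** Integrate a continuous function against the law of the random family
    [fun x => {b | A b x}], a family that need not define a point of [K] for
    every [x].  Its trace on a finite [s] almost surely is the trace of a point,
    whence the average [avg g s] over the finitely many traces; these averages
    are bounded by the norm of [g] and an ultralimit over [s] is a functional.
    On [g] built from the generators in [s] the average is constant beyond [s]. *)
Lemma dual_of_measure : exists phi : dual (CK R K),
  forall (g : CK R K) s (y : {fset pos B} -> R),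
    (forall x, g x = \sum_(r <- fpowerset s) y r * \1_(hat (J N r)) x) ->
    sval phi g = \sum_(r <- fpowerset s) y r * fine (nu (joint r)).
Proof.
have [pt ptP] := point_choice.
have [U [UU FU]] := ultraFilterLemma (fset_filter_proper (pos B)).
pose w s t := fine (nu (atom s t)).
pose avg (g : CK R K) s : R := \sum_(t <- fpowerset s) w s t * g (pt s t).
have sum_w s : \sum_(t <- fpowerset s) w s t = 1.
  have := sum_atom (fsub0set s); rewrite /joint set_fset0 bigcap_set0 nuT /= => <-.
  by apply: eq_bigr => t _; rewrite fsub0set mulr1.
have avg_le g s : `|avg g s| <= `|g|.
  rewrite -[leRHS]mul1r -(sum_w s) mulr_suml.
  apply: le_trans (ler_norm_sum _ _ _) _; apply: ler_sum => t _.
  rewrite normrM ger0_norm ?fine_ge0//.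
  by rewrite ler_wpM2l ?fine_ge0//; exact: ler_sup_norm.
have avg_cvg g : exists2 l, `|l| <= `|g| & avg g s @[s --> U] --> l.
  exact: ultralimit_bounded (avg_le g).
have /choice[L LP] := fun g => let: ex_intro2 l p q := avg_cvg g in
  ex_intro (fun l => `|l| <= `|g| /\ avg g s @[s --> U] --> l) l (conj p q).
have Llim g l : avg g s @[s --> U] --> l -> L g = l.
  by move=> gl; apply: (cvg_unique _ _ gl); [exact: norm_hausdorff|exact: (LP g).2].
have Llin : linear (L : CK R K -> R^o).
  move=> a g h; apply: Llim.
  have -> : avg (a *: g + h) = fun s => a * avg g s + avg h s.
    apply/funext => s; rewrite /avg mulr_sumr -big_split /=.
    by apply: eq_bigr => t _; rewrite mulrDr mulrCA.
  by apply: cvgD; [apply: cvgMl_tmp; exact: (LP g).2|exact: (LP h).2].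
pose phi : {linear CK R K -> R^o} :=
  HB.pack (L : CK R K -> R^o) (GRing.isLinear.Build _ _ _ _ (L : CK R K -> R^o) Llin).
have phi_cont : continuous phi.
  apply: bounded_linear_continuous; apply/linear_boundedP.
  near=> M => g; apply: le_trans (LP g).1 _.
  by rewrite ler_peMl//; near: M; exact: nbhs_pinfty_ge.
exists (exist _ phi phi_cont) => g s y gE /=; apply: Llim.
apply: cvg_near_cst; apply: FU; exists s => s' ss'.
rewrite /avg big_seq.
under eq_bigr => t ts'.
  have -> : w s' t * g (pt s' t) =
      \sum_(r <- fpowerset s) y r * (w s' t * (r `<=` t)%fset%:R).
    rewrite (sum_gens_in gE) mulr_sumr big_seq [RHS]big_seq; apply: eq_bigr => r.
    rewrite fpowersetE => rs; rewrite mulrCA; have [w0|w0] := eqVneq (w s' t) 0.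
      by rewrite w0 !mul0r.
    congr (_ * (_ * _%:R)); congr nat_of_bool.
    have t0 : nu (joint t) <> 0%E.
      move=> t0; move: w0; rewrite /w (_ : nu _ = 0%E) ?eqxx//.
      apply: subset_measure0 t0; [exact: measurable_atom|exact: measurable_joint|].
      move=> x xt b bt; apply/(xt b _)=> //.
      by move: ts'; rewrite fpowersetE => /fsubsetP; apply.
    have ptE b : b \in s -> (b \in gens_in s (pt s' t)) = (b \in t).
      move=> bs; rewrite !inE bs /=; apply/asboolP/idP.
        by move/(ptP s' t t0 _ (fsubsetP ss' _ bs)).
      by move=> bt; apply/(ptP s' t t0 _ (fsubsetP ss' _ bs)).
    apply/fsubsetP/fsubsetP => rt b br; have := rt b br.
      by rewrite ptE// (fsubsetP rs).
    by rewrite ptE// (fsubsetP rs).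
  over.
rewrite -big_seq exchange_big /= big_seq [RHS]big_seq; apply: eq_bigr => r.
rewrite fpowersetE => rs; rewrite -mulr_sumr sum_atom//.
exact: fsubset_trans rs ss'.
Unshelve. all: by end_near.
Qed.

End functional.

(** * The measure of finite meets *)

Section mass.
Local Open Scope quotient_scope.
Local Set Implicit Arguments.
Local Unset Strict Implicit.
Context d (T : measurableType d) (R : realType) (mu : probability T R).
Local Notation B := (malg mu).
Local Notation nu := (mu : {measure set T -> \bar R}).

Definition rep_pos (b : pos B) : set T := rep (val b).
Definition mass (r : {fset pos B}) : R := fine (nu (joint rep_pos r)).

Lemma measurable_rep_pos b : measurable (rep_pos b).
Proof. exact: measurable_rep. Qed.

Lemma measure_joint_rep r : nu (joint rep_pos r) = (mass r)%:E.
Proof.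
rewrite /mass fineK// fin_num_measure//.
exact: (measurable_joint measurable_rep_pos).
Qed.

Lemma mass_eq0 r : nu (joint rep_pos r) = 0%E <-> mass r = 0.
Proof. by rewrite measure_joint_rep; split=> [[]|->]. Qed.

Lemma subset_joint (X : choiceType) (A : X -> set T) (r t : {fset X}) :
  (r `<=` t)%fset ->
  \bigcap_(b in [set` t]) A b `<=` \bigcap_(b in [set` r]) A b.
Proof. by move=> rt x xt b br; apply: xt; exact: (fsubsetP rt). Qed.

Lemma mass_sub (r t : {fset pos B}) : (r `<=` t)%fset -> mass t != 0 -> mass r != 0.
Proof.
move=> rt; apply: contra => /eqP/mass_eq0 r0; apply/eqP/mass_eq0.
apply: subset_measure0 r0; [| |exact: subset_joint];
  exact: (measurable_joint measurable_rep_pos).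
Qed.

Lemma meet_class (r : {fset pos B}) (mr : measurable (joint rep_pos r)) :
  \pi_B (Mset mr) = (\meet_(b <- r) val b)%O.
Proof.
have meetE (l : seq (pos B)) : (\meet_(b <- l) val b)%O =
    \pi_B (\big[@msetI _ _/@msetT _ _]_(b <- l) repr (val b)).
  elim: l => [|b l IH]; first by rewrite !big_nil.
  by rewrite !big_cons IH -[X in (X `&` _)%O]reprK; exact: malg_meetE.
rewrite meetE; apply: malg_ext => /=.
rewrite (big_morph (fun C : Defs.mset T => \val C) (id1 := setT) (op1 := setI))//.
by rewrite /joint bigcap_fset.
Qed.

(** The classes of a finite set of events have as meet the class of their
    intersection, and this class is the bottom element when the intersection
    is null. *)
Lemma mass_neq0P (r : {fset pos B}) : mass r != 0 <->
  exists2 c : B, c != \bot%O & forall b, b \in r -> (c <= val b)%O.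
Proof.
have mr := measurable_joint measurable_rep_pos r.
have r0 : (mass r != 0) = (\pi_B (Mset mr) != \bot%O).
  congr (~~ _); apply/eqP/eqP.
    by move/mass_eq0 => r0; apply/malg_eq0.
  by move/malg_eq0 => r0; apply/mass_eq0.
rewrite r0 meet_class; split=> [rn|[c c0 cr]].
  by exists (\meet_(b <- r) val b)%O => // b br; exact: meets_inf_seq.
apply: contra c0; rewrite -!lex0; apply: le_trans.
by rewrite big_seq; elim/big_ind: _ => // x y cx cy; rewrite lexI cx cy.
Qed.

Context (N : pos B -> set nat) (indepN : independent N).
Local Notation K := (K N).

Lemma mass_gens_in (s : {fset pos B}) (F : K) : mass (gens_in s F) != 0.
Proof.
apply/mass_neq0P; apply: (@hat_le_meet _ _ N F) => b.
by rewrite !inE /= => /andP[_ /asboolP].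
Qed.

Lemma mass_point (s t : {fset pos B}) : mass t != 0 ->
  exists F : K, forall b, b \in s -> (hat (G N b) F <-> b \in t).
Proof.
move=> /mass_neq0P[c c0 ct].
apply: (point_of_meet indepN _ _ c0 ct) => a a0; exact: malg_ultrafilter.
Qed.

(** The event that the random family contains [b], when the family consists of
    the generators in [Q] that contain the random point. *)
Definition thin (Q : pred (pos B)) (b : pos B) : set T :=
  if Q b then rep_pos b else set0.

Lemma measurable_thin Q b : measurable (thin Q b).
Proof. by rewrite /thin; case: ifP => _ //; exact: measurable_rep_pos. Qed.

Lemma joint_thin Q (r : {fset pos B}) :
  joint (thin Q) r = if all Q r then joint rep_pos r else set0.
Proof.
rewrite /joint; case: ifPn => [/allP Qr|/allPn[b br Qb]].
  by apply: eq_bigcapr => b br; rewrite /thin Qr.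
by apply/seteqP; split=> // x /(_ b br); rewrite /thin (negPf Qb).
Qed.

Lemma measure_joint_thin Q r : nu (joint (thin Q) r) = ((all Q r)%:R * mass r)%:E.
Proof.
by rewrite joint_thin; case: ifP => _; rewrite ?measure0 ?mul0r// mul1r measure_joint_rep.
Qed.

(** The family is the set of generators in [Q] that contain a random point. *)
Lemma dual_mass (Q : pred (pos B)) : exists phi : dual (CK R K),
  forall (g : CK R K) s (y : {fset pos B} -> R),
    (forall x, g x = \sum_(r <- fpowerset s) y r * \1_(hat (J N r)) x) ->
    sval phi g = \sum_(r <- fpowerset s) y r * mass r * (all Q r)%:R.
Proof.
have [|s t t0|phi phiP] := @dual_of_measure _ B N _ T R mu (thin Q) (measurable_thin Q).
- exact: probability_setT.
- apply: mass_point; apply/eqP => m0; apply: t0.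
  by rewrite measure_joint_thin m0 mulr0.
exists phi => g s y gE; rewrite (phiP _ _ _ gE); apply: eq_bigr => r _.
by rewrite measure_joint_thin /= -mulrA [mass r * _]mulrC.
Qed.

(** Drawing two independent points and keeping the generators that contain both
    squares the probabilities.  The pair of values [y * m] and [y * m ^+ 2]
    determines [m] and [y] as soon as [y * m] is not zero. *)
Lemma dual_mass2 (Q : pred (pos B)) : exists phi : dual (CK R K),
  forall (g : CK R K) s (y : {fset pos B} -> R),
    (forall x, g x = \sum_(r <- fpowerset s) y r * \1_(hat (J N r)) x) ->
    sval phi g = \sum_(r <- fpowerset s) y r * mass r ^+ 2 * (all Q r)%:R.
Proof.
pose A2 b := thin Q b `*` thin Q b.
have joint2 r : joint A2 r = joint (thin Q) r `*` joint (thin Q) r.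
  rewrite /joint; apply/seteqP; split=> [x xr|x [x1 x2] b br].
    by split=> b br; have [] := xr b br.
  by split; [exact: x1|exact: x2].
have mu2 r : (mu \x mu)%E (joint A2 r) = ((all Q r)%:R * mass r ^+ 2)%:E.
  have mr := measurable_joint (measurable_thin Q) r.
  rewrite joint2 product_measure1E//.
  apply: etrans (congr2 mule (measure_joint_thin Q r) (measure_joint_thin Q r)) _.
  rewrite -EFinM; congr EFin.
  by case: all; rewrite ?mul0r// !mul1r expr2.
have mu2T : (mu \x mu)%E [set: T * T] = 1%E.
  rewrite -setXTT product_measure1E//.
  by apply: etrans (congr2 mule (probability_setT mu) (probability_setT mu)) _; rewrite mule1.
have [b||s t t0|phi phiP] := @dual_of_measure _ B N _ (T * T)%type R (mu \x mu)%E A2.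
- by apply: measurableX; exact: measurable_thin.
- exact: mu2T.
- apply: mass_point; apply/eqP => m0; apply: t0.
  by apply: etrans (mu2 t) _; rewrite m0 expr0n mulr0.
exists phi => g s y gE; rewrite (phiP _ _ _ gE); apply: eq_bigr => r _.
rewrite -mulrA [mass r ^+ 2 * _]mulrC; congr (_ * _).
exact: (congr1 fine (mu2 r)).
Qed.

End mass.

(** * Recovering coefficients from cells *)

(** Moebius inversion on a Boolean lattice.  If [c] is properly contained in [u],
    toggling a point of [u :\: c] is a sign-reversing involution of the terms. *)
Lemma moebius_powerset (R : realFieldType) (X : finType) (c u : {set X}) :
  \sum_(v : {set X} | v \subset u) (-1) ^+ #|u :\: v| * (c \subset v)%:R
  = (c == u)%:R :> R.
Proof.
have [->|cu] := eqVneq c u.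
  rewrite (bigD1 u)//= finset.setDv cards0 expr0 subxx mulr1 big1 ?addr0// => v /andP[vu nvu].
  case: (boolP (u \subset v)) => uv; last by rewrite mulr0.
  by move: nvu; rewrite finset.eqEsubset vu uv.
have [cu'|ncu] := boolP (c \subset u); last first.
  rewrite big1// => v vu; case: (boolP (c \subset v)) => [cv|]; last by rewrite mulr0.
  by move: ncu; rewrite (fintype.subset_trans cv vu).
have /set0Pn[x] : u :\: c != finset.set0.
  by rewrite finset.setD_eq0; apply: contra cu => uc; rewrite finset.eqEsubset cu' uc.
rewrite inE => /andP[xc xu].
pose h (v : {set X}) : {set X} := if x \in v then v :\ x else x |: v.
have hK : involutive h.
  move=> v; rewrite /h; case: (boolP (x \in v)) => xv.
    by rewrite !inE eqxx /= finset.setD1K.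
  by rewrite !inE eqxx /= finset.setU1K.
have hin v : (x \in h v) = (x \notin v).
  by rewrite /h; case: ifP => xv; rewrite !inE eqxx.
have hne v z : z != x -> (z \in h v) = (z \in v).
  by move=> zx; rewrite /h; case: ifP => xv; rewrite !inE (negPf zx).
set S := \sum_(_ | _) _.
suff : S = - S by move=> /eqP; rewrite -addr_eq0 -mulr2n mulrn_eq0 /= => /eqP.
rewrite {1}/S (reindex_inj (inv_inj hK)) /S -sumrN.
apply: eq_big => [v|v vu].
  apply/fintype.subsetP/fintype.subsetP => vu z zv.
    by have [->//|zx] := eqVneq z x; apply: vu; rewrite hne.
  have [->//|zx] := eqVneq z x; apply: vu; by rewrite -hne.
have -> : (c \subset h v) = (c \subset v).
  apply/fintype.subsetP/fintype.subsetP => cv z zc;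
    have zx : z != x by apply: contraNneq xc => <-.
    by rewrite -hne// cv.
  by rewrite hne// cv.
rewrite -mulNr; congr (_ * _).
rewrite (cardsD1 x) (cardsD1 x (u :\: v)) !inE xu hin !andbT.
have -> : (u :\: h v) :\ x = (u :\: v) :\ x.
  by apply/setP => z; rewrite !inE; case: eqVneq => //= zx; rewrite hne.
by rewrite negbK !exprD; case: (x \in v); rewrite !expr1 !expr0 mulN1r ?mul1r ?opprK.
Qed.

Section cells.
Local Set Implicit Arguments.
Local Unset Strict Implicit.
Context (P : choiceType) (X : finType) (f : P -> X).

Definition cells (r : {fset P}) : {set X} :=
  [set x | has (fun b => f b == x) r]%SET.

Lemma cells_subset r (v : {set X}) :
  (cells r \subset v) = all (fun b => f b \in v) r.
Proof.
apply/fintype.subsetP/allP => rv.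
  by move=> b br; apply: rv; rewrite inE; apply/hasP; exists b.
by move=> x; rewrite inE => /hasP[b br /eqP<-]; exact: rv.
Qed.

Context (s : {fset P}) (f_inj : {in s &, injective f}).

(** As [f] is injective on [s], an element of [s] is determined by its cell. *)
Lemma cells_mono (r t : {fset P}) : (r `<=` s)%fset -> (t `<=` s)%fset ->
  (cells r \subset cells t) = (r `<=` t)%fset.
Proof.
move=> /fsubsetP rs /fsubsetP ts; rewrite cells_subset; apply/allP/fsubsetP => rt b br.
  have := rt _ br; rewrite inE => /hasP[b' b't /eqP /f_inj].
  by move=> <- //; [exact: ts|exact: rs].
by rewrite inE; apply/hasP; exists b => //; exact: rt.
Qed.

Lemma cells_inj (r t : {fset P}) : (r `<=` s)%fset -> (t `<=` s)%fset ->
  (cells r == cells t) = (r == t).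
Proof. by move=> rs ts; rewrite finset.eqEsubset eqEfsubset !cells_mono. Qed.

Context (R : realType) (y m : {fset P} -> R).

Definition cell_sum (c : {fset P} -> R) (v : {set X}) : R :=
  \sum_(r <- fpowerset s) c r * (cells r == v)%:R.

Lemma moebius_cell_sum c (a : {set X} -> R) :
  (forall v, a v = \sum_(r <- fpowerset s) c r * (cells r \subset v)%:R) ->
  forall u : {set X},
    \sum_(v : {set X} | v \subset u) (-1) ^+ #|u :\: v| * a v = cell_sum c u.
Proof.
move=> aE u; under eq_bigr do rewrite aE mulr_sumr.
rewrite exchange_big; apply: eq_bigr => r _ /=.
by under eq_bigr do rewrite mulrCA; rewrite -mulr_sumr moebius_powerset.
Qed.

Lemma cell_sum_cells c r : (r `<=` s)%fset -> cell_sum c (cells r) = c r.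
Proof.
move=> rs; rewrite /cell_sum (big_fsetD1 r) ?fpowersetE//= eqxx mulr1.
rewrite big_seq big1 ?addr0// => t; rewrite !inE fpowersetE => /andP[tr ts].
by rewrite cells_inj// (negPf tr) mulr0.
Qed.

Lemma cell_sum_neq0 c v : cell_sum c v != 0 ->
  exists2 r, (r `<=` s)%fset & v = cells r.
Proof.
move=> c0; apply: contrapT => nv; move/eqP: c0; apply.
rewrite /cell_sum big_seq big1// => r; rewrite fpowersetE => rs.
by case: eqP => [rv|]; [case: nv; exists r|rewrite mulr0].
Qed.

(** Each cell sum has at most one term.  Where it has none, or a term with [m]
    equal to zero, the quotient is [0 / 0 = 0]; where the term is nonzero the
    quotient is its coefficient [y]. *)
Lemma sum_coef_cells (t : {fset P}) : (t `<=` s)%fset ->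
  (forall r, (r `<=` s)%fset -> y r != 0) ->
  (forall r, (r `<=` t)%fset -> m r != 0) ->
  \sum_(v : {set X} | v \subset cells t)
     cell_sum (fun r => y r * m r) v ^+ 2 / cell_sum (fun r => y r * m r ^+ 2) v
  = \sum_(r <- fpowerset s) y r * (r `<=` t)%fset%:R.
Proof.
move=> ts y0 m0.
pose z r := (y r * m r) ^+ 2 / (y r * m r ^+ 2).
have zE v : cell_sum (fun r => y r * m r) v ^+ 2 / cell_sum (fun r => y r * m r ^+ 2) v
    = cell_sum z v.
  have [[r [rs ->]]|nv] := pselect (exists r, (r `<=` s)%fset /\ v = cells r).
    by rewrite !cell_sum_cells.
  have c0 c : cell_sum c v = 0.
    apply/eqP; apply: contrapT => /negP/cell_sum_neq0[r rs vr].
    by apply: nv; exists r.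
  by rewrite !c0 expr0n mul0r.
under eq_bigr do rewrite zE.
rewrite exchange_big /= big_seq [RHS]big_seq; apply: eq_bigr => r.
rewrite fpowersetE => rs; rewrite -mulr_sumr big_mkcond /= (bigD1 (cells r))//= eqxx.
rewrite big1 ?addr0 => [|v vr]; last by rewrite eq_sym (negPf vr) if_same.
rewrite cells_mono//; case: (boolP (r `<=` t)%fset) => rt; last by rewrite !mulr0.
by congr (_ * _); rewrite /z exprMn -mulf_div divff ?expf_neq0 ?m0// mulr1 expr2 mulfK// y0.
Qed.

End cells.

(** * Measurability *)

Section measurability.
Context (R : realType).

Lemma measurable_invr : measurable_fun setT (@GRing.inv R).
Proof.
have -> : [set: R] = [set 0] `|` ~` [set 0] by rewrite setUv.
apply/measurable_funU => //; first exact: measurableC.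
split; first exact: measurable_fun_set1.
apply: open_continuous_measurable_fun => [|x]; first by apply: closed_openC; exact: closed_eq.
by rewrite inE => /= /eqP; exact: inv_continuous.
Qed.

Lemma measurable_bigmax d (T : measurableType d) (I : Type) (s : seq I)
    (h : I -> T -> R) (D : set T) :
  (forall i, measurable_fun D (h i)) ->
  measurable_fun D (fun x => \big[Num.max/0]_(i <- s) h i x).
Proof.
move=> mh; elim: s => [|i s IH].
  by under eq_fun do rewrite big_nil; exact: measurable_cst.
by under eq_fun do rewrite big_cons; exact: measurable_maxr.
Qed.

(** A functional is a coordinate projection of the product defining the weak
    topology, hence weakly continuous. *)
Lemma measurable_dual (E : normedModType R) (phi : dual E) :
  measurable_fun setT
    (sval phi : g_sigma_algebraType (baire_gen R (weak E)) -> R).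
Proof.
apply: (measurability _ (RGenOInfty.measurableE R)) => _ [_ [a ->] <-].
rewrite setTI; apply: sub_sigma_algebra; exists (sval phi); split.
  have phiE : (sval phi : weak E -> R) = proj phi \o @dual_eval R E by [].
  rewrite phiE => x.
  apply: (@continuous_comp (weak E) (prod_topology _) R (@dual_eval R E) (proj phi)).
    exact: (@initial_continuous E _ (@dual_eval R E)).
  exact: (@proj_continuous {classic (dual E)} (fun=> R) phi).
by exists `]a, +oo[%classic.
Qed.
End measurability.

Lemma measurable_sum_cond d (T : measurableType d) (R : realType) (I : Type)
    (s : seq I) (P : pred I) (h : I -> T -> R) (D : set T) :
  (forall i, measurable_fun D (h i)) ->
  measurable_fun D (fun x => \sum_(i <- s | P i) h i x).
Proof.
move=> mh; under eq_fun do rewrite big_mkcond /=.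
by apply: measurable_sum => i; case: (P i).
Qed.

Lemma measurable_moebius_dual (R : realType) (E : normedModType R) (X : finType)
    (phi : {set X} -> dual E) (u : {set X}) :
  measurable_fun setT ((fun g => \sum_(v : {set X} | v \subset u)
    (-1) ^+ #|u :\: v| * sval (phi v) g) :
      g_sigma_algebraType (baire_gen R (weak E)) -> R).
Proof.
apply: measurable_sum_cond => v.
apply: measurable_funM; first exact: measurable_cst.
exact: measurable_dual.
Qed.

(** * The approximating norms *)

Section norm.
Local Set Implicit Arguments.
Local Unset Strict Implicit.
Context d (T : measurableType d) (R : realType) (mu : probability T R).
Context (N : pos (malg mu) -> set nat) (indepN : independent N).
Local Notation P := (pos (malg mu)).
Local Notation C := (CK R (K N)).
Local Notation X j := ({ffun 'I_j -> bool}).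

(** The cells are the atoms of the algebra generated by the sets
    [[set b | N b i]] with [i < j]; by independence they separate
    any finite set of generators once [j] is large. *)
Definition cell (j : nat) (b : P) : X j := [ffun i : 'I_j => (i : nat) \in N b].

Lemma cell_separates (s : {fset P}) :
  exists j0, forall j, (j0 <= j)%N -> {in s &, injective (cell j)}.
Proof.
have /choice[h hP] (bb : P * P) : exists n : nat,
    bb.1 != bb.2 -> (n \in N bb.1) != (n \in N bb.2).
  case: bb => b b' /=; have [->|bb'] := eqVneq b b'; first by exists 0%N.
  have bb'D : [disjoint [fset b] & [fset b']]%fset.
    by rewrite fdisjoint1X in_fset1.
  have [n [nb nb']] := indepN bb'D.
  exists n => _; have -> : n \in N b by rewrite inE; apply: nb; rewrite inE.
  have -> // : n \in N b' = false.
  by apply/negP; rewrite inE; apply: nb'; rewrite inE.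
exists (\max_(b <- s) \max_(b' <- s) (h (b, b')).+1)%N => j js b b' bs b's eb.
apply: contrapT => /eqP /(hP (b, b')) /=.
have hj : (h (b, b') < j)%N.
  apply: leq_trans js.
  pose hh b := (\max_(b' <- s) (h (b, b')).+1)%N.
  apply: leq_trans (@leq_bigmax_seq _ (enum_fset s) xpredT hh b bs isT).
  exact: (@leq_bigmax_seq _ (enum_fset s) xpredT (fun b' => (h (b, b')).+1) b' b's isT).
by move/ffunP : eb => /(_ (Ordinal hj)); rewrite !ffunE /= => ->; rewrite eqxx.
Qed.

Definition cell_dual j (v : {set X j}) : dual C :=
  sval (cid (dual_mass indepN (fun b => cell j b \in v))).
Definition cell_dual2 j (v : {set X j}) : dual C :=
  sval (cid (dual_mass2 indepN (fun b => cell j b \in v))).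

Definition cell_mass j (u : {set X j}) (g : C) : R :=
  \sum_(v : {set X j} | v \subset u) (-1) ^+ #|u :\: v| * sval (cell_dual v) g.
Definition cell_mass2 j (u : {set X j}) (g : C) : R :=
  \sum_(v : {set X j} | v \subset u) (-1) ^+ #|u :\: v| * sval (cell_dual2 v) g.

(** Once the cells separate the generators of [g], whose coefficients do not
    vanish, the factor [cell_mass u g != 0] selects the [u] that are the cells
    of a set of generators with nonzero meet. *)
Definition approx_norm j (g : C) : R :=
  \big[Num.max/0]_(u : {set X j}) ((cell_mass u g != 0)%:R *
    `|\sum_(v : {set X j} | v \subset u) cell_mass v g ^+ 2 / cell_mass2 v g|).

Section value.
Context (g : C) (s : {fset P}) (y : {fset P} -> R).
Context (gE : forall x, g x = \sum_(r <- fpowerset s) y r * \1_(hat (J N r)) x).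

Lemma cell_massE j (u : {set X j}) :
  cell_mass u g = cell_sum (cell j) s (fun r => y r * mass r) u.
Proof.
apply: (@moebius_cell_sum _ _ _ _ _ _ (fun v => sval (cell_dual v) g)) => v.
rewrite /cell_dual; case: cid => phi /= /(_ _ _ _ gE) ->.
by apply: eq_bigr => r _; rewrite cells_subset.
Qed.

Lemma cell_mass2E j (u : {set X j}) :
  cell_mass2 u g = cell_sum (cell j) s (fun r => y r * mass r ^+ 2) u.
Proof.
apply: (@moebius_cell_sum _ _ _ _ _ _ (fun v => sval (cell_dual2 v) g)) => v.
rewrite /cell_dual2; case: cid => phi /= /(_ _ _ _ gE) ->.
by apply: eq_bigr => r _; rewrite cells_subset.
Qed.

Context (y0 : forall r, (r `<=` s)%fset -> y r != 0).

(** Both inequalities rest on the correspondence of the [t `<=` s] of nonzero mass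
    with the traces on [s] of the points of [K]: such a [t] gives a value of [g],
    and every value of [g] arises in this way. *)
Lemma approx_normE j : {in s &, injective (cell j)} -> approx_norm j g = `|g|.
Proof.
move=> inj.
have coefE t : (t `<=` s)%fset -> mass t != 0 ->
    \sum_(v : {set X j} | v \subset cells (cell j) t) cell_mass v g ^+ 2 / cell_mass2 v g
    = \sum_(r <- fpowerset s) y r * (r `<=` t)%fset%:R.
  move=> ts t0; rewrite -(sum_coef_cells inj ts y0 (m := @mass _ _ _ mu)).
    by apply: eq_bigr => v _; rewrite cell_massE cell_mass2E.
  by move=> r rt; exact: mass_sub t0.
apply/le_anti/andP; split.
  apply: bigmax_le => [|u _]; first exact: normr_ge0.
  have [|u0] := eqVneq (cell_mass u g) 0; first by rewrite mul0r normr_ge0.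
  rewrite mul1r; move: u0; rewrite cell_massE => u0.
  have [t ts ut] := cell_sum_neq0 u0; move: u0; rewrite ut cell_sum_cells// mulf_eq0.
  rewrite negb_or => /andP[_ t0]; rewrite coefE//.
  have [F FP] := mass_point indepN s t0.
  have -> : t = gens_in s F.
    apply/fsetP => b; rewrite !inE; have [bs|bs] := boolP (b \in s) => /=.
      by apply/idP/asboolP => /FP; apply.
    by apply: contraNF bs; exact: (fsubsetP ts).
  by rewrite -(sum_gens_in gE); exact: ler_sup_norm.
apply: sup_norm_le => [|F].
  by apply: (big_ind (fun x : R => 0 <= x)) => // x z x0 z0; rewrite le_max x0.
have ts : (gens_in s F `<=` s)%fset by apply/fsubsetP => b; rewrite !inE => /andP[].
rewrite (sum_gens_in gE) -coefE ?mass_gens_in//.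
apply: le_trans (le_bigmax _ _ (cells (cell j) (gens_in s F))).
by rewrite cell_massE cell_sum_cells// mulf_neq0 ?y0 ?mass_gens_in// mul1r.
Qed.

End value.

Local Notation W := (g_sigma_algebraType (baire_gen R (weak C))).

Lemma measurable_approx_norm j :
  measurable_fun setT (approx_norm j : W -> R).
Proof.
have ma u : measurable_fun setT (cell_mass u : W -> R) by exact: measurable_moebius_dual.
have mb u : measurable_fun setT (cell_mass2 u : W -> R) by exact: measurable_moebius_dual.
have mV (h : W -> R) : measurable_fun setT h -> measurable_fun setT (fun g => (h g)^-1).
  by apply: measurableT_comp; exact: measurable_invr.
apply: measurable_bigmax => u; apply: measurable_funM.
  have -> : (fun g : W => (cell_mass u g != 0)%:R : R) =
      (fun g => cell_mass u g / cell_mass u g).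
    apply/funext => g; have [->|a0] := eqVneq (cell_mass u g) 0; first by rewrite mul0r.
    by rewrite divff.
  by apply: measurable_funM; [exact: ma|apply: mV; exact: ma].
apply: measurableT_comp => //.
apply: measurable_sum_cond => v.
apply: measurable_funM; first by apply: measurable_funX; exact: ma.
by apply: mV; exact: mb.
Qed.

(** On [SK'] the approximating norms are eventually equal to the norm, so
    membership of the norm in [Y] is the same as eventual membership of the
    approximating norms, a countable combination of measurable conditions. *)
Lemma norm_trace_measurable (Y : set R) : measurable Y ->
  strace <<s baire_gen R (weak C) >> (SK' N R) (SK' N R `&` [set g : C | Y `|g|]).
Proof.
move=> mY.
pose E : set W := \bigcup_j0 \bigcap_(j in [set j | (j0 <= j)%N])
  (approx_norm j : W -> R) @^-1` Y.
exists E.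
  apply: (@bigcupT_measurable _ W) => j0.
  apply: bigcap_measurable => [|j _]; first by exists j0 => /=.
  have := @measurable_approx_norm j measurableT Y mY; rewrite setTI; exact.
have normE g : SK' N R g ->
    exists j0, forall j, (j0 <= j)%N -> approx_norm j g = `|g|.
  move=> [_ [s [y [y0 gE]]]]; have [j0 inj] := cell_separates s.
  by exists j0 => j j0j; exact: approx_normE gE y0 _ (inj j j0j).
rewrite setIC; apply/seteqP; split=> g [gS gY]; split=> //.
  have [j0 gj0] := normE g gS; have [j1 _ gj1] := gY.
  have := gj1 (maxn j0 j1) (leq_maxr _ _).
  by rewrite /preimage /= gj0// leq_maxl.
have [j0 gj0] := normE g gS; exists j0 => // j j0j.
by rewrite /preimage /= gj0.
Qed.
End norm.

Theorem theorem3p10 (R : realType) (I : choiceType)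
    (omega1_le : ~ countable [set: I])
    (le_continuum : ([set: I] #<= [set: R])%card)
    (lambda : probability (baire_cube R I) R)
    (lambda_coin : is_coin_measure lambda)
    (N : pos (malg lambda) -> set nat) (indepN : independent N) :
  forall Y : set R, measurable Y ->
    strace <<s baire_gen R (weak (CK R (K N))) >> (SK' N R)
      (SK' N R `&` [set g : CK R (K N) | Y `|g|]).
Proof. by move=> Y; exact: norm_trace_measurable. Qed.
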